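(* Let $n\ge1$ and consider a uniform configuration $\mathcal{A}=\{a_0,\dots,a_{m+n}\}\subset\mathbb{Z}^n$ of cardinality $N$ and codimension $m=N-n-1\ge0$. Then, for any non-zero polynomial $f(x)=\sum_{i=0}^{m+n}c_ix^{a_i}$ with support $\mathcal{A}$ and any point $\mathbf{q}\in V(f)\subset(\mathbb{C}^* )^n$, we have $$\mu(f;\mathbf{q})\le 1+\lceil m/n\rceil=\lceil (N-1)/n\rceil.$$
   Context: A configuration $\mathcal{A}\subset\mathbb{Z}^n$ of $N\ge n+1$ points is uniform if any subset of $n+1$ elements of $\mathcal{A}$ is affinely independent (equivalently, all maximal minors of the matrix with columns $(1,a_i)$ are non-zero). $V(f)$ is the zero set of the (Laurent) polynomial $f$ (complex coefficients) in the torus $(\mathbb{C}^* )^n$. The multiplicity $\mu(f;\mathbf{q})$ of $f$ at a zero $\mathbf{q}$ is the maximal $k\ge1$ such that $f$ and all its partial derivatives up to order $k-1$ vanish at $\mathbf{q}$. *)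

(* Defs.v *)
From HB Require Import structures.
From mathcomp Require Import all_boot all_order all_algebra.
From mathcomp Require Import finmap complex monalg reals.

Set Implicit Arguments.
Unset Strict Implicit.
Unset Printing Implicit Defensive.

Import Order.TTheory GRing.Theory Num.Theory.

Local Open Scope fset_scope.
Local Open Scope ring_scope.

Definition affinely_independent (n : nat) (B : {fset 'rV[int]_n}) : Prop :=
  forall l : 'rV[int]_n -> rat,
    \sum_(b <- B) l b = 0 ->
    \sum_(b <- B) l b *: map_mx (intr : int -> rat) b = 0 ->
    forall b, b \in B -> l b = 0.

Definition uniform_configuration (n : nat) (A : {fset 'rV[int]_n}) : Prop :=
  forall B : {fset 'rV[int]_n},
    B `<=` A -> #|` B| = n.+1 -> affinely_independent B.

(* Only the module structure of {malg C['rV[int]_n]} is available (monalg's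
   product excludes exponents with inverses); it is all that is needed here. *)
Notation laurent C n := {malg C['rV[int]_n]}.

Section Laurent.
Context {C : fieldType} {n : nat}.

Definition lmonom_eval (q : 'rV[C]_n) (a : 'rV[int]_n) : C :=
  \prod_(j < n) q 0 j ^ a 0 j.

Definition leval (f : laurent C n) (q : 'rV[C]_n) : C :=
  \sum_(a <- msupp f) f@_a * lmonom_eval q a.

Definition lderiv (j : 'I_n) (f : laurent C n) : laurent C n :=
  \sum_(a <- msupp f) << f@_a *~ a 0 j *g a - delta_mx 0 j >>.

Definition lderivs (s : seq 'I_n) (f : laurent C n) : laurent C n :=
  foldr lderiv f s.

Definition in_torus (q : 'rV[C]_n) : Prop := forall j, q 0 j != 0.

Definition derivs_vanish_below (f : laurent C n) (q : 'rV[C]_n) (k : nat) :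
    Prop :=
  forall s : seq 'I_n, (size s < k)%N -> leval (lderivs s f) q = 0.

Definition is_multiplicity (f : laurent C n) (q : 'rV[C]_n) (k : nat) : Prop :=
  [/\ (0 < k)%N, derivs_vanish_below f q k
    & forall l, derivs_vanish_below f q l -> (l <= k)%N].

End Laurent.

(* Main.v *)
Require Import Defs.
From HB Require Import structures.
From mathcomp Require Import all_boot all_order all_algebra.
From mathcomp Require Import finmap complex monalg reals.
From mathcomp Require Import boolp.

(** Let [w_a = f_a q^a], where [a] runs over the exponents of [f].  If the
    derivatives of [f] of order at most [d] vanish at [q], then the weights
    [w_a] annihilate every polynomial [P] of degree at most [d], that is
    [\sum_a w_a P(a) = 0]: the Euler operator [x_j d/dx_j] multiplies the
    coefficient of [x^a] by [a_j], so polynomials in the exponent are realised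
    by differential operators of the same order.

    On the other hand uniformity produces a polynomial of small degree that
    isolates one exponent.  Fix [a0] with [f_a0 != 0].  Through at most [n] of the
    other [m + n] points of [A] always passes a hyperplane that avoids [a0].  Since
    [r = 1 + ceil (m / n)] groups of at most [n] points exhaust [A \ a0], the product
    of [r] affine functions vanishes on [A \ a0] and not at [a0].  If [f]
    vanished at [q] with all its derivatives of order at most [r], this would
    force [w_a0 = 0], impossible in the torus.

    The polynomial [P] is a product of affine factors, and these are applied
    to the coefficients of [f] one at a time.  Each such twist costs one order of
    vanishing (derivs_vanish_below_twist) and removes up to [n] points from the
    support (separating_affine_function); the induction is
    no_high_order_vanishing. *)

Set Implicit Arguments.
Unset Strict Implicit.
Unset Printing Implicit Defensive.

Import Order.TTheory GRing.Theory Num.Theory.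

Local Open Scope fset_scope.
Local Open Scope ring_scope.

(** * Twisting the coefficients of a Laurent polynomial *)

Section Twist.
Context {C : fieldType} {n : nat}.
Implicit Types (f g : laurent C n) (q : 'rV[C]_n) (a b e : 'rV[int]_n).
Implicit Types (h : 'rV[int]_n -> C).

(** The common form of the operators used below: derivation [lderiv j] is the
    case [h a = a_j], [e = - e_j], multiplication by [x_j] is the case [h = 1],
    [e = e_j], and for [e = 0] the coefficients are rescaled in place. *)
Definition twist_shift h e f : laurent C n :=
  \sum_(a <- msupp f) << f@_a * h a *g a + e >>.

Definition twist h f : laurent C n := twist_shift h 0 f.

Definition mulX (j : 'I_n) f : laurent C n :=
  twist_shift (fun=> 1) (delta_mx 0 j) f.

Lemma mcoeff_twist_shift h e f b :
  (twist_shift h e f)@_b = f@_(b - e) * h (b - e).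
Proof.
rewrite /twist_shift raddf_sum /=.
under eq_bigr => a _ do rewrite mcoeffU.
have [fb|fb] := boolP (b - e \in msupp f).
  rewrite (big_fsetD1 _ fb) /= subrK eqxx mulr1n big1_fset ?addr0 // => a.
  rewrite !inE => /andP[ab _] _.
  by rewrite -[b in _ == b](subrK e) (inj_eq (addIr e)) (negbTE ab).
rewrite (mcoeff_outdom fb) mul0r big1_fset // => a fa _.
rewrite -[b in _ == b](subrK e) (inj_eq (addIr e)).
by case: eqP fa fb => // -> ->.
Qed.

Lemma mcoeff_twist h f b : (twist h f)@_b = f@_b * h b.
Proof. by rewrite mcoeff_twist_shift subr0. Qed.

Lemma mcoeff_mulX j f b : (mulX j f)@_b = f@_(b - delta_mx 0 j).
Proof. by rewrite mcoeff_twist_shift mulr1. Qed.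

Lemma mcoeff_lderiv j f b :
  (lderiv j f)@_b = f@_(b + delta_mx 0 j) * (b 0 j + 1)%:~R.
Proof.
have -> : lderiv j f = twist_shift (fun a => (a 0 j)%:~R) (- delta_mx 0 j) f.
  by apply: eq_bigr => a _; rewrite mulrzr.
by rewrite mcoeff_twist_shift opprK !mxE !eqxx.
Qed.

Lemma lderiv0 j : lderiv j 0 = 0 :> laurent C n.
Proof. by rewrite /lderiv msupp0 big_seq_fset0. Qed.

Lemma mcoeff_linear c f g b : (c *: f + g)@_b = c * f@_b + g@_b.
Proof. by rewrite mcoeffD [X in X + _]mcoeffZ. Qed.

Lemma lderiv_linear j c f g :
  lderiv j (c *: f + g) = c *: lderiv j f + lderiv j g.
Proof.
apply/malgP => b; rewrite [RHS]mcoeff_linear [LHS]mcoeff_lderiv.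
rewrite [X in X * _ = _]mcoeff_linear.
rewrite [X in _ = _ * X + _]mcoeff_lderiv [X in _ = _ + X]mcoeff_lderiv.
by rewrite mulrDl mulrA.
Qed.

Lemma lderivs_linear s c f g :
  lderivs s (c *: f + g) = c *: lderivs s f + lderivs s g.
Proof. by elim: s => //= j s ->; rewrite lderiv_linear. Qed.

Lemma leval_fsubset f q (B : {fset 'rV[int]_n}) : msupp f `<=` B ->
  leval f q = \sum_(a <- B) f@_a * lmonom_eval q a.
Proof.
move=> sfB; apply: big_fset_incl => // a _ /mcoeff_outdom ->.
by rewrite mul0r.
Qed.

Lemma leval_linear c f g q :
  leval (c *: f + g) q = c * leval f q + leval g q.
Proof.
pose B := msupp (c *: f + g) `|` (msupp f `|` msupp g).
rewrite !(@leval_fsubset _ _ B); last 3 first.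
- by rewrite fsubsetU // fsubsetUr orbT.
- by rewrite fsubsetU // fsubsetUl orbT.
- exact: fsubsetUl.
rewrite mulr_sumr -big_split; apply: eq_bigr => a _.
by rewrite [X in X * _ = _]mcoeff_linear mulrDl mulrA.
Qed.

Lemma leval0 q : leval 0 q = 0.
Proof. by rewrite /leval msupp0 big_seq_fset0. Qed.

Lemma levalU c a q : leval << c *g a >> q = c * lmonom_eval q a.
Proof.
by rewrite (leval_fsubset _ (msuppU_le)) big_seq_fset1 mcoeffUU.
Qed.

Lemma leval_twist_shift h e f q : leval (twist_shift h e f) q =
  \sum_(a <- msupp f) f@_a * h a * lmonom_eval q (a + e).
Proof.
rewrite /twist_shift (big_morph (leval^~ q) (id1 := 0) (op1 := +%R)).
- by apply: eq_bigr => a _; rewrite levalU.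
- by move=> f1 f2; rewrite -[f1 in LHS]scale1r leval_linear mul1r.
- exact: leval0.
Qed.

Lemma lmonom_eval_neq0 q a : in_torus q -> lmonom_eval q a != 0.
Proof.
by move=> tq; apply/prodf_neq0 => j _; rewrite expfz_neq0.
Qed.

(** The torus hypothesis lets [q_j ^ (a_j + 1)] split as a product also for
    negative [a_j]: at [q_j = 0] it would fail for [a_j = -1]. *)
Lemma leval_mulX j f q : in_torus q -> leval (mulX j f) q = q 0 j * leval f q.
Proof.
move=> tq; rewrite leval_twist_shift mulr_sumr; apply: eq_bigr => a _.
rewrite mulr1 mulrCA; congr (_ * _).
rewrite /lmonom_eval (bigD1 j) // [in RHS](bigD1 j) //= mulrA.
rewrite !mxE !eqxx expfzDr ?tq // expr1z [_ * q 0 j]mulrC; congr (_ * _).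
by apply: eq_bigr => i ij; rewrite !mxE (negbTE ij) andbF addr0.
Qed.

Lemma derivs_vanish_below_le f q k l :
  (k <= l)%N -> derivs_vanish_below f q l -> derivs_vanish_below f q k.
Proof. by move=> kl vf s sk; apply: vf; apply: leq_trans kl. Qed.

(** Peels off the innermost derivation, so that inductions on the order of
    vanishing can apply their hypothesis to [lderiv j f]. *)
Lemma derivs_vanish_belowS f q k : derivs_vanish_below f q k.+1 <->
  leval f q = 0 /\ forall j, derivs_vanish_below (lderiv j f) q k.
Proof.
split=> [vf|[f0 vf] s].
  split=> [|j s sk]; first exact: (vf [::]).
  have := vf (rcons s j); rewrite size_rcons ltnS => /(_ sk).
  by rewrite /lderivs foldr_rcons.
case/lastP: s => [//|s j]; rewrite size_rcons ltnS => /(vf j).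
by rewrite /lderivs foldr_rcons.
Qed.

Lemma derivs_vanish_below_linear c f g q k :
  derivs_vanish_below f q k -> derivs_vanish_below g q k ->
  derivs_vanish_below (c *: f + g) q k.
Proof.
move=> vf vg s sk.
by rewrite lderivs_linear leval_linear vf // vg // mulr0 addr0.
Qed.

Lemma derivs_vanish_below0 q k : derivs_vanish_below 0 q k.
Proof.
suff l0 s : lderivs s 0 = 0 :> laurent C n by move=> s _; rewrite l0 leval0.
by elim: s => //= j s ->; exact: lderiv0.
Qed.

Lemma lderiv_mulX i j f :
  lderiv i (mulX j f) = (i == j)%:R *: f + mulX j (lderiv i f).
Proof.
apply/malgP => b.
rewrite [LHS]mcoeff_lderiv [RHS]mcoeff_linear.
rewrite [X in X * _ = _]mcoeff_mulX [X in _ = _ + X]mcoeff_mulX.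
rewrite [X in _ = _ + X]mcoeff_lderiv !mxE eqxx /=.
have [->|ij] := eqVneq i j.
  by rewrite addrK !subrK intrD mulrDr mulr1 mul1r addrC.
by rewrite mul0r add0r addrAC subr0.
Qed.

(** By the Leibniz rule lderiv_mulX, a derivative of [x_j f] is [x_j] times a
    derivative of [f], plus possibly [f] itself, which vanishes to a higher
    order than required. *)
Lemma derivs_vanish_below_mulX j f q k : in_torus q ->
  derivs_vanish_below f q k -> derivs_vanish_below (mulX j f) q k.
Proof.
move=> tq; elim: k f => [|k IH] f // vf.
have /derivs_vanish_belowS[f0 vdf] := vf.
apply/derivs_vanish_belowS.
split=> [|i]; first by rewrite leval_mulX // f0 mulr0.
rewrite lderiv_mulX; apply: derivs_vanish_below_linear (IH _ (vdf i)).
exact: derivs_vanish_below_le vf.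
Qed.

(** Coefficientwise, the Euler operator [x_j d/dx_j] is multiplication by the
    exponent [a_j]. *)
Lemma twist_affine (c : C) (v : 'I_n -> C) f :
  twist (fun a => c + \sum_j v j * (a 0 j)%:~R) f =
  c *: f + \sum_j v j *: mulX j (lderiv j f).
Proof.
apply/malgP => b; rewrite [LHS]mcoeff_twist [RHS]mcoeff_linear mulrDr.
rewrite [X in _ = _ + X]raddf_sum /=.
rewrite [f@_b * c]mulrC mulr_sumr; congr (_ + _); apply: eq_bigr => j _.
rewrite [RHS]mcoeffZ [X in _ = _ * X]mcoeff_mulX.
rewrite [X in _ = _ * X]mcoeff_lderiv.
rewrite !mxE !eqxx !subrK.
by rewrite mulrCA.
Qed.

(** An affine twist is a differential operator of order one, by twist_affine,
    so it costs one order of vanishing. *)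
Lemma derivs_vanish_below_twist (c : C) (v : 'I_n -> C) f q k :
  in_torus q -> derivs_vanish_below f q k.+1 ->
  derivs_vanish_below (twist (fun a => c + \sum_j v j * (a 0 j)%:~R) f) q k.
Proof.
move=> tq vf; have /derivs_vanish_belowS[_ vdf] := vf.
rewrite twist_affine; apply: derivs_vanish_below_linear.
  exact: derivs_vanish_below_le vf.
elim/big_rec: _ => [|j g _ vg]; first exact: derivs_vanish_below0.
by apply: derivs_vanish_below_linear vg; apply: derivs_vanish_below_mulX.
Qed.

End Twist.

(** * Hyperplanes through points of a uniform configuration *)

Lemma fset_extend (K : choiceType) (A B : {fset K}) k :
  B `<=` A -> (#|` B| <= k <= #|` A|)%N ->
  exists D : {fset K}, [/\ B `<=` D, D `<=` A & #|` D| = k].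
Proof.
move=> sBA /andP[Bk kA].
elim: k Bk kA => [|k IH] Bk kA.
  by exists B; split=> //; apply/eqP; rewrite -leqn0.
have [<-|neq] := eqVneq #|` B| k.+1; first by exists B; split.
have [|D [sBD sDA Dk]] := IH _ (ltnW kA).
  by rewrite -ltnS ltn_neqAle neq Bk.
have /fsubsetPn[a aA aD] : ~~ (A `<=` D).
  by apply: contraL kA => /fsubset_leq_card; rewrite Dk -ltnNge ltnS.
exists (a |` D); split; last by rewrite cardfsU1 aD Dk.
- exact: fsubset_trans (fsubsetUr _ _).
- by rewrite fsubUset fsub1set aA.
Qed.

(** [n + 1] affinely independent points give an invertible matrix with rows
    [(1, b)]; a column of its inverse lists the coefficients of the affine
    function that takes the value 1 at the corresponding point and 0 at the
    others. *)
Lemma affine_dual_function n (B : {fset 'rV[int]_n}) a0 :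
  affinely_independent B -> #|` B| = n.+1 -> a0 \in B ->
  exists (c : rat) (v : 'I_n -> rat), forall b, b \in B ->
    c + \sum_j v j * (b 0 j)%:~R = (b == a0)%:R.
Proof.
move=> indB cardB a0B.
(* The columns are indexed by [option 'I_n] through [unlift ord0]: column 0
   holds the constants 1 and column [lift ord0 j] the [j]-th coordinates. *)
pose M := \matrix_(i < n.+1, j < n.+1)
  oapp (fun j' => ((nth 0 B i) 0 j')%:~R : rat) 1 (unlift ord0 j).
have idx b : b \in B -> (index b B < n.+1)%N by rewrite -cardB index_mem.
have uM : M \in unitmx.
  rewrite -row_free_unit; apply: inj_row_free => u uM0.
  pose l (b : 'rV[int]_n) := u 0 (inord (index b B)).
  have sumE (V : nmodType) (F : 'rV[int]_n -> rat -> V) :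
      \sum_(b <- B) F b (l b) = \sum_(i < n.+1) F (nth 0 B i) (u 0 i).
    rewrite (big_nth 0) cardB big_mkord; apply: eq_bigr => i _.
    by rewrite /l index_uniq ?fset_uniq ?cardB // inord_val.
  have col j : \sum_i u 0 i * M i j = 0.
    by have /rowP/(_ j) := uM0; rewrite !mxE.
  have l0 : forall b, b \in B -> l b = 0.
    apply: indB.
      rewrite (sumE _ (fun _ x => x)) -[RHS](col ord0); apply: eq_bigr => i _.
      by rewrite mxE unlift_none mulr1.
    rewrite (sumE _ (fun b x => x *: map_mx intr b)).
    apply/rowP => j; rewrite summxE [RHS]mxE -[RHS](col (lift ord0 j)).
    by apply: eq_bigr => i _; rewrite !mxE liftK.
  apply/rowP => i; rewrite mxE -(l0 (nth 0 B i)) ?mem_nth ?cardB //.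
  by rewrite /l index_uniq ?fset_uniq ?cardB // inord_val.
pose w := invmx M *m (delta_mx (inord (index a0 B)) 0 : 'cV_n.+1).
have Mw : M *m w = delta_mx (inord (index a0 B)) 0 by rewrite mulKVmx.
exists (w ord0 0), (fun j => w (lift ord0 j) 0) => b bB.
have /matrixP/(_ (inord (index b B)) 0) := Mw.
rewrite !mxE big_ord_recl !mxE unlift_none mul1r andbT => eb.
rewrite -[b == a0](_ :
  (inord (index b B) == inord (index a0 B) :> 'I_n.+1) = _).
  rewrite -eb; congr (_ + _); apply: eq_bigr => j _.
  by rewrite !mxE liftK /= mulrC inordK ?idx // nth_index.
rewrite -val_eqE /= !inordK ?idx //; apply/eqP/eqP => [|-> //].
by move/(congr1 (nth 0 B)); rewrite !nth_index.
Qed.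

(** Uniformity speaks of subsets of exactly [n + 1] points, so [a0 :: s] is
    first completed to such a subset of [A]. *)
Lemma separating_affine_function n (A : {fset 'rV[int]_n}) a0
    (s : seq 'rV[int]_n) :
  uniform_configuration A -> (n < #|` A|)%N -> a0 \in A ->
  {subset s <= A} -> a0 \notin s -> (size s <= n)%N ->
  exists (c : rat) (v : 'I_n -> rat),
    c + \sum_j v j * (a0 0 j)%:~R = 1 /\
    forall b, b \in s -> c + \sum_j v j * (b 0 j)%:~R = 0.
Proof.
move=> unifA nA a0A ssA a0s sn.
pose B : {fset 'rV[int]_n} := [fset x in a0 :: s].
have [|| D [sBD sDA Dn]] := @fset_extend _ A B n.+1.
- apply/fsubsetP => x; rewrite !inE => /predU1P[->//|]; exact: ssA.
- by rewrite nA andbT card_fseq (leq_trans (size_undup _)).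
have memD x : x \in a0 :: s -> x \in D.
  by move=> xs; apply: (fsubsetP sBD); rewrite !inE in xs *.
have [|c [v cv]] := affine_dual_function (unifA _ sDA Dn) Dn (a0 := a0).
  by apply: memD; rewrite mem_head.
exists c, v; split=> [|b bs]; rewrite cv ?memD ?mem_head // ?inE ?bs ?orbT //.
  by rewrite eqxx.
by case: eqP bs a0s => // -> ->.
Qed.

(** * The bound on the multiplicity *)

(** Each step twists [f] by an affine function that is 1 at [a0] and kills the
    next [n] exponents of [s].  When [s] is used up, [f] is a single monomial,
    which vanishes nowhere in the torus. *)
Lemma no_high_order_vanishing (C : numFieldType) n (A : {fset 'rV[int]_n}) a0
    (q : 'rV[C]_n) r (s : seq 'rV[int]_n) (f : laurent C n) :
  uniform_configuration A -> (n < #|` A|)%N -> in_torus q -> a0 \in A ->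
  {subset s <= A} -> a0 \notin s -> (size s <= r * n)%N ->
  {subset msupp f <= a0 :: s} -> f@_a0 != 0 ->
  ~ derivs_vanish_below f q r.+1.
Proof.
move=> unifA nA tq a0A.
elim: r s f => [|r IH] s f ssA a0s sr sf fa0 vf.
  have := vf [::] isT; move: sr sf.
  rewrite mul0n leqn0 size_eq0 => /eqP -> sf /=.
  rewrite (@leval_fsubset _ _ _ _ [fset a0]).
    rewrite big_seq_fset1; apply/eqP; rewrite mulf_neq0 //.
    exact: lmonom_eval_neq0.
  by apply/fsubsetP => x /sf; rewrite !inE.
have ssT x : x \in take n s -> x \in s := @mem_take _ _ _ _.
have ssDr x : x \in drop n s -> x \in s := @mem_drop _ _ _ _.
have [|||c [v [cv0 cv]]] :=
  @separating_affine_function _ A a0 (take n s) unifA nA a0A.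
- by move=> x /ssT /ssA.
- by apply: contra a0s => /ssT.
- by rewrite size_take_min geq_minl.
pose h (a : 'rV[int]_n) : C := ratr c + \sum_j ratr (v j) * (a 0 j)%:~R.
have hE a : h a = ratr (c + \sum_j v j * (a 0 j)%:~R).
  rewrite rmorphD rmorph_sum; congr (_ + _); apply: eq_bigr => j _.
  by rewrite rmorphM rmorph_int.
apply: (IH (drop n s) (twist h f)).
- by move=> x /ssDr /ssA.
- by apply: contra a0s => /ssDr.
- by rewrite size_drop leq_subLR -mulSn.
- move=> x; rewrite -mcoeff_neq0 mcoeff_twist mulf_eq0 negb_or mcoeff_neq0.
  case/andP=> /sf; rewrite !inE => /predU1P[->|]; first by rewrite eqxx.
  rewrite -{1}(cat_take_drop n s) mem_cat => /orP[/cv xs|->]; last first.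
    by rewrite orbT.
  by rewrite hE xs rmorph0 eqxx.
- by rewrite mcoeff_twist hE cv0 rmorph1 mulr1.
- exact: derivs_vanish_below_twist.
Qed.

(** The multiplicity is the largest order of vanishing; without an a priori
    bound, as given by the second hypothesis, it need not exist ([f = 0]). *)
Lemma is_multiplicity_exists (C : fieldType) n (f : laurent C n)
    (q : 'rV[C]_n) r :
  leval f q = 0 -> ~ derivs_vanish_below f q r.+1 ->
  exists2 mu, is_multiplicity f q mu & (mu <= r)%N.
Proof.
move=> fq0 nvf.
pose P k := `[< derivs_vanish_below f q k >].
have P1 : P 1%N by apply/asboolP => -[].
have Ple k : P k -> (k <= r)%N.
  move=> /asboolP vk; rewrite leqNgt; apply/negP => rk.
  by apply: nvf; apply: derivs_vanish_below_le vk.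
have [mu /asboolP vmu mu_max] := ex_maxnP (ex_intro P _ P1) Ple.
exists mu; last by apply: Ple; apply/asboolP.
split=> // [|l vl]; first exact: mu_max.
by apply: mu_max; apply/asboolP.
Qed.

Theorem theorem9p5 (R : realType) (n m : nat) (A : {fset 'rV[int]_n})
    (f : laurent R[i] n) (q : 'rV[R[i]]_n) :
  (1 <= n)%N ->
  #|` A| = (m + n).+1 ->
  uniform_configuration A ->
  f != 0 ->
  msupp f `<=` A ->
  in_torus q ->
  leval f q = 0 ->
  exists mu : nat,
    [/\ is_multiplicity f q mu,
        mu%:Z <= 1 + Num.ceil (m%:R / n%:R : rat)
      & 1 + Num.ceil (m%:R / n%:R : rat)
        = Num.ceil ((#|` A|%:R - 1) / n%:R : rat)].
Proof.
move=> n0 cardA unifA f0 sfA tq fq0.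
have nR0 : 0 < n%:R :> rat by rewrite ltr0n.
have [c E] : exists c : nat, Num.ceil (m%:R / n%:R : rat) = c%:Z.
  have : 0 <= Num.ceil (m%:R / n%:R : rat).
    by rewrite ceil_ge0 (lt_le_trans _ (divr_ge0 _ _)).
  by case: (Num.ceil _) => // c _; exists c.
have mc : (m <= c * n)%N.
  have := ceil_ge (m%:R / n%:R : rat).
  by rewrite E ler_pdivrMr // -natrM ler_nat.
have [a0 fa0] : exists a0, f@_a0 != 0.
  have [//|nf] := pselect (exists a0, f@_a0 != 0).
  case/eqP: f0; apply/malgP => a; rewrite mcoeff0; apply/eqP/negPn/negP => fa.
  by apply: nf; exists a.
have a0A : a0 \in A by apply: (fsubsetP sfA); rewrite -mcoeff_neq0.
have nvf : ~ derivs_vanish_below f q c.+2.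
  apply: (@no_high_order_vanishing _ _ A a0 q c.+1 (A `\ a0)) => //.
  - by rewrite cardA ltnS leq_addl.
  - by move=> x; rewrite !inE => /andP[].
  - by rewrite !inE eqxx.
  - have := cardfsD1 a0 A; rewrite a0A cardA add1n => -[<-].
    by rewrite mulSn addnC leq_add2l.
  - by move=> x /(fsubsetP sfA) xA; rewrite !inE xA andbT orbN.
have [mu mu_mult mu_le] := is_multiplicity_exists fq0 nvf.
exists mu; split=> //; first by rewrite E.
rewrite cardA -natr1 addrK natrD mulrDl divff ?gt_eqF //.
by rewrite ceilDrz ?rpred1 // ceil1 E addrC.
Qed.
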